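(* Let $L_\infty$ be the generalised carpet (limit set) defined by a sequence of nonempty patterns $\{\mathcal{A}_k\}_{k=1}^{\infty}$ with width-sequence $\{m_k\}_{k=1}^{\infty}$, $m_k\ge 2$ for all $k\ge 1$. Suppose that 1. there exist two distinct types of patterns $\mathcal{T}_1,\mathcal{T}_2\in\{\mathcal{V},\mathcal{H},\mathcal{D}_1,\mathcal{D}_2\}$ such that infinitely many patterns occurring in the sequence $\{\mathcal{A}_k\}_{k=1}^{\infty}$ are of type $\mathcal{T}_1$ and infinitely many patterns occurring in the sequence are of type $\mathcal{T}_2$, and 2. infinitely many patterns occurring in the sequence $\{\mathcal{A}_k\}_{k=1}^{\infty}$ are of type $\mathcal{C}_1$ and infinitely many are of type $\mathcal{C}_2$. Then $L_\infty$ is totally disconnected with respect to the Euclidean topology.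
   Context: Squares and patterns. For $m\ge 1$ and $0\le i,j\le m-1$ let $S^m_{i,j}=[\frac im,\frac{i+1}m]\times[\frac jm,\frac{j+1}m]$ and $\mathcal{S}_m=\{S^m_{i,j}\mid 0\le i,j\le m-1\}$. An $m$-pattern is a nonempty subset $\mathcal{A}\subseteq\mathcal{S}_m$; put $\mathcal{A}^c=\mathcal{S}_m\setminus\mathcal{A}$. The left column, right column, bottom row and top row of $\mathcal{S}_m$ are respectively the sets $\{S^m_{0,j}\}_j$, $\{S^m_{m-1,j}\}_j$, $\{S^m_{i,0}\}_i$, $\{S^m_{i,m-1}\}_i$. Construction. For a square $Q=[x,x+q]\times[y,y+q]\subseteq[0,1]^2$ let $P_Q(z_x,z_y)=(qz_x+x,\,qz_y+y)$. A sequence of patterns $\{\mathcal{A}_k\}_{k\ge1}$ has width-sequence $\{m_k\}_{k\ge 1}$ if $\mathcal{A}_k\subseteq\mathcal{S}_{m_k}$ for all $k$. Let $\mathcal{W}_1=\mathcal{A}_1$ and, for $n\ge2$, $\mathcal{W}_n=\{P_{W'}(W)\mid W\in\mathcal{A}_n,\ W'\in\mathcal{W}_{n-1}\}$ (the white squares of level $n$). Let $L_n=\bigcup_{W\in\mathcal{W}_n}W$ and $L_\infty=\bigcap_{n\ge1}L_n$; $L_\infty$ is the generalised carpet defined by $\{\mathcal{A}_k\}$. Graph. For $\mathcal{W}\subseteq\mathcal{S}_m$, $\mathcal{G}(\mathcal{W})$ is the graph whose vertices are the squares in $\mathcal{W}$ and whose edges are the unordered pairs of distinct squares of $\mathcal{W}$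 with nonempty intersection (sharing a side or a corner). A set $K\subseteq\mathcal{A}^c$ is identified with a connected component of $\mathcal{G}(\mathcal{A}^c)$ if it is the vertex set of that component. A component $K$ ''connects'' two rows/columns if it contains a square from each of them. Types of an $m$-pattern $\mathcal{A}$. Type $\mathcal{V}$: $\mathcal{G}(\mathcal{A}^c)$ has a connected component $K$ connecting the top and the bottom row of $\mathcal{S}_m$ for which there are indices $i_1,i_2$ with $S^m_{i_1,m-1}\in K$, $S^m_{i_2,0}\in K$ and $i_2\in\{i_1-1,i_1,i_1+1\}$. Type $\mathcal{H}$: $\mathcal{G}(\mathcal{A}^c)$ has a connected component $K$ connecting the left and the right column of $\mathcal{S}_m$ for which there are indices $j_1,j_2$ with $S^m_{0,j_1}\in K$, $S^m_{m-1,j_2}\in K$ and $j_2\in\{j_1-1,j_1,j_1+1\}$. Type $\mathcal{D}_1$: either (1) $\mathcal{G}(\mathcal{A}^c)$ has a connected component $K$ with $\{S^m_{0,0},S^m_{m-1,m-1}\}\subseteq K$; or (2) $\mathcal{G}(\mathcal{A}^c)$ has a connected component $K_1$ connecting the left column and the top row and a connected component $K_2$ connecting the bottom row and the right column, such that there are $j_1,j_2$ with $S^m_{0,j_1}\in K_1$, $S^m_{m-1,j_2}\in K_2$, $j_2\in\{j_1-1,j_1,j_1+1\}$, and there are $i_1,i_2$ with $S^m_{i_1,m-1}\in K_1$, $S^m_{i_2,0}\in K_2$, $i_2\in\{i_1-1,i_1,i_1+1\}$. Type $\mathcal{D}_2$: either (1) $\mathcal{G}(\mathcal{A}^c)$ has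 a connected component $K$ with $\{S^m_{0,m-1},S^m_{m-1,0}\}\subseteq K$; or (2) $\mathcal{G}(\mathcal{A}^c)$ has a connected component $K_1$ connecting the left column and the bottom row and a connected component $K_2$ connecting the top row and the right column, such that there are $j_1,j_2$ with $S^m_{0,j_1}\in K_1$, $S^m_{m-1,j_2}\in K_2$, $j_2\in\{j_1-1,j_1,j_1+1\}$, and there are $i_1,i_2$ with $S^m_{i_1,0}\in K_1$, $S^m_{i_2,m-1}\in K_2$, $i_2\in\{i_1-1,i_1,i_1+1\}$. Type $\mathcal{C}_1$: $\{S^m_{0,0},S^m_{m-1,m-1}\}\cap\mathcal{A}^c\neq\emptyset$. Type $\mathcal{C}_2$: $\{S^m_{0,m-1},S^m_{m-1,0}\}\cap\mathcal{A}^c\neq\emptyset$. A pattern may be of several types. The same letters denote the families of all patterns of the respective types. *)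

(* Defs.v *)
From HB Require Import structures.
From mathcomp Require Import all_boot all_order all_algebra.
From mathcomp Require Import all_classical all_reals all_analysis.

Set Implicit Arguments.
Unset Strict Implicit.
Unset Printing Implicit Defensive.

Import Order.TTheory GRing.Theory Num.Theory.
Import numFieldNormedType.Exports.

Local Open Scope classical_set_scope.
Local Open Scope ring_scope.

(* A collection of squares of S_m is given by the finite set of its indices:
   (i, j) : 'I_m * 'I_m stands for the square S^m_{i,j} of column i (counted
   from the left) and row j (counted from the bottom). *)
Notation squares m := {set ('I_m * 'I_m)%type}.

Definition box (R : realType) (x y q : R) : set (R * R) :=
  `[x, x + q] `*` `[y, y + q].

Definition square (R : realType) (m : nat) (p : 'I_m * 'I_m) : set (R * R) :=
  `[p.1%:R / m%:R, p.1.+1%:R / m%:R] `*` `[p.2%:R / m%:R, p.2.+1%:R / m%:R].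
Arguments square R {m} p.

(* The map P_Q for Q = box x y q. *)
Definition place (R : realType) (x y q : R) (z : R * R) : R * R :=
  (q * z.1 + x, q * z.2 + y).

(* Levels are counted from 0: [A n] is the pattern A_{n+1} and [white A n] is
   the set W_{n+1} of white squares, each one being a set of points. *)
Fixpoint white (R : realType) (m : nat -> nat) (A : forall k, squares (m k))
    (n : nat) : set (set (R * R)) :=
  match n with
  | 0%N => [set Y | exists2 p, p \in A 0%N & Y = square R p]
  | n'.+1 => [set Y | exists (x y q : R) p,
      [/\ 0 < q, @white R m A n' (box x y q), p \in A n'.+1
        & Y = place x y q @` square R p]]
  end.
Arguments white R {m} A n.

Definition white_union (R : realType) (m : nat -> nat)
    (A : forall k, squares (m k)) (n : nat) : set (R * R) :=
  \bigcup_(Y in white R A n) Y.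
Arguments white_union R {m} A n.

Definition carpet (R : realType) (m : nat -> nat)
    (A : forall k, squares (m k)) : set (R * R) :=
  \bigcap_n white_union R A n.
Arguments carpet R {m} A.

Definition square_adjacent (R : realType) (m : nat) (W : squares m) :
    rel ('I_m * 'I_m) :=
  fun p p' => [&& p \in W, p' \in W, p != p'
                & `[< square R p `&` square R p' !=set0 >]].

(* K is the vertex set of a connected component of the graph G(W). *)
Definition component (R : realType) (m : nat) (W K : squares m) : Prop :=
  exists2 p, p \in W & K = finset (connect (square_adjacent R W) p).

(* S^m_{i,j} is a member of K; false when i or j is not smaller than m. *)
Definition contains (m : nat) (K : squares m) (i j : nat) : bool :=
  [exists p in K, (p.1 == i :> nat) && (p.2 == j :> nat)].

Definition left_column (m : nat) : squares m :=
  finset (fun p : 'I_m * 'I_m => p.1 == 0%N :> nat).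
Definition right_column (m : nat) : squares m :=
  finset (fun p : 'I_m * 'I_m => p.1 == m.-1 :> nat).
Definition bottom_row (m : nat) : squares m :=
  finset (fun p : 'I_m * 'I_m => p.2 == 0%N :> nat).
Definition top_row (m : nat) : squares m :=
  finset (fun p : 'I_m * 'I_m => p.2 == m.-1 :> nat).

Definition connects (m : nat) (K B C : squares m) : bool :=
  (K :&: B != finset.set0) && (K :&: C != finset.set0).

(* i2 \in {i1 - 1, i1, i1 + 1}, without truncated subtraction. *)
Definition within_one (i1 i2 : nat) : bool :=
  [|| i2.+1 == i1, i2 == i1 | i2 == i1.+1].

Definition type_V (R : realType) (m : nat) (A : squares m) : Prop :=
  exists K : squares m,
    [/\ component R (~: A) K, connects K (top_row m) (bottom_row m)
      & exists i1 i2, [/\ contains K i1 m.-1, contains K i2 0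
                        & within_one i1 i2]].

Definition type_H (R : realType) (m : nat) (A : squares m) : Prop :=
  exists K : squares m,
    [/\ component R (~: A) K, connects K (left_column m) (right_column m)
      & exists j1 j2, [/\ contains K 0 j1, contains K m.-1 j2
                        & within_one j1 j2]].

Definition type_D1 (R : realType) (m : nat) (A : squares m) : Prop :=
  (exists K : squares m,
     [/\ component R (~: A) K, contains K 0 0 & contains K m.-1 m.-1])
  \/
  (exists K1 K2 : squares m,
     [/\ component R (~: A) K1 /\ connects K1 (left_column m) (top_row m),
         component R (~: A) K2 /\ connects K2 (bottom_row m) (right_column m),
         exists j1 j2, [/\ contains K1 0 j1, contains K2 m.-1 j2
                         & within_one j1 j2]
       & exists i1 i2, [/\ contains K1 i1 m.-1, contains K2 i2 0
                         & within_one i1 i2]]).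

Definition type_D2 (R : realType) (m : nat) (A : squares m) : Prop :=
  (exists K : squares m,
     [/\ component R (~: A) K, contains K 0 m.-1 & contains K m.-1 0])
  \/
  (exists K1 K2 : squares m,
     [/\ component R (~: A) K1 /\ connects K1 (left_column m) (bottom_row m),
         component R (~: A) K2 /\ connects K2 (top_row m) (right_column m),
         exists j1 j2, [/\ contains K1 0 j1, contains K2 m.-1 j2
                         & within_one j1 j2]
       & exists i1 i2, [/\ contains K1 i1 0, contains K2 i2 m.-1
                         & within_one i1 i2]]).

Definition type_C1 (m : nat) (A : squares m) : bool :=
  contains (~: A) 0 0 || contains (~: A) m.-1 m.-1.

Definition type_C2 (m : nat) (A : squares m) : bool :=
  contains (~: A) 0 m.-1 || contains (~: A) m.-1 0.

Inductive pattern_type := TypeV | TypeH | TypeD1 | TypeD2.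

Definition has_type (R : realType) (t : pattern_type) (m : nat)
    (A : squares m) : Prop :=
  match t with
  | TypeV => type_V R A
  | TypeH => type_H R A
  | TypeD1 => type_D1 R A
  | TypeD2 => type_D2 R A
  end.

(* Main.v *)
Require Import Defs.
From HB Require Import structures.
From mathcomp Require Import all_boot all_order all_algebra.
From mathcomp Require Import all_classical all_reals all_analysis.
From mathcomp Require Import zify ring lra.
Import Order.TTheory GRing.Theory Num.Theory.
Import numFieldNormedType.Exports.
Local Open Scope classical_set_scope.
Local Open Scope ring_scope.

Set Implicit Arguments.
Unset Strict Implicit.
Unset Printing Implicit Defensive.

(** Tile the plane periodically with a pattern of width [m].  For a pattern
    of type V, H, D1 or D2 the black cells of this tiling contain a chain of
    cells, consecutive ones sharing a side or a corner, leading from a cell to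
    its translate by [m] times (0,1), (1,0), (1,1) or (-1,1).  The
    periodic extension of the chain is a barrier within a strip of width
    [O(m)]: the parity of the number of crossings of a horizontal ray with it
    does not change when one moves between non-black cells that share a side.

    Two white squares that touch only at a corner become disjoint at the next
    level with a pattern of type C1 (resp. C2), which removes one of the two
    small squares at that corner.  Hence two white squares of a late level [N]
    meet only if their ancestors of level [n] are equal or share a side, so
    that the parity colours the squares of level [N] such that squares of
    different colours are disjoint.  A connected subset of the carpet therefore
    crosses no barrier of level [n], and the linear form constant along the
    direction of the barrier varies on it by [O(1 / (m_1 ... m_(n-1)))].  Two
    types give two independent linear forms, both constant on connected sets. *)


(** * Crossing parity of chains of lattice cells *)

Definition near_cell (u v : int * int) : bool :=
  [&& u.1 <= v.1 + 1, v.1 <= u.1 + 1, u.2 <= v.2 + 1 & v.2 <= u.2 + 1].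

Definition side_cell (u v : int * int) : bool :=
  near_cell u v && ((u.1 == v.1) || (u.2 == v.2)).

(** The ray starts at [c] and runs to the right between the rows [c.2] and [c.2 + 1]. A diagonal
    step has its ends in two columns; the one in row [c.2] decides whether the step counts. *)
Definition crosses (c u v : int * int) : bool :=
  [&& u.2 == c.2, v.2 == c.2 + 1 & c.1 < u.1]
  || [&& v.2 == c.2, u.2 == c.2 + 1 & c.1 < v.1].

Fixpoint parity (c u : int * int) (p : seq (int * int)) : bool :=
  if p is v :: p' then crosses c u v (+) parity c v p' else false.

(** The two rays disagree only on a step with an end at [(c.1 + 1, c.2)], a cell that the chain
    avoids. *)
Lemma parity_right (c u : int * int) p :
    (c.1 + 1, c.2) \notin u :: p ->
  parity (c.1 + 1, c.2) u p = parity c u p.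
Proof.
elim: p u => //= v p IH u; rewrite inE negb_or => /andP[cu cp].
rewrite IH //; congr (_ (+) _); move: cp cu; rewrite inE negb_or => /andP[cv _].
move: cv; rewrite /crosses -!pair_eqE /=; case: c u v {IH} => [x y] [u1 u2] [v1 v2] /=.
lia.
Qed.

(** A correction term: moving the ray up one row changes the count at each step by the difference of
    this indicator at the two ends. *)
Definition right_above (c w : int * int) : bool :=
  (w.2 == c.2 + 1) && (c.1 < w.1).

(** Within the rows [c.2] and [c.2 + 1], a step that avoids [c] and the cell above it cannot jump
    over the column [c.1], so both its ends lie on the same side of that column. *)
Lemma crosses_up (c u v : int * int) :
    near_cell u v -> c != u -> c != v ->
    (c.1, c.2 + 1) != u -> (c.1, c.2 + 1) != v ->
  crosses (c.1, c.2 + 1) u v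
    = crosses c u v (+) (right_above c u (+) right_above c v).
Proof.
rewrite /right_above /crosses /near_cell -!pair_eqE /=.
case: c u v => [x y] [u1 u2] [v1 v2] /=.
have y1 : (y + 1 == y) = false by lia.
have y2 : (y + 1 + 1 == y) = false by lia.
have y3 : (y + 1 + 1 == y + 1) = false by lia.
have y4 : (y == y + 1) = false by lia.
have y5 : (y == y + 1 + 1) = false by lia.
have y6 : (y + 1 == y + 1 + 1) = false by lia.
(* Each end is in row [y], [y + 1], [y + 2] or elsewhere; once the rows are fixed only comparisons
   of columns remain. *)
have [->|n1] := eqVneq u2 y; [|have [->|n2] := eqVneq u2 (y + 1);
  [|have [->|n3] := eqVneq u2 (y + 1 + 1)]];
(have [->|n1'] := eqVneq v2 y; [|have [->|n2'] := eqVneq v2 (y + 1);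
  [|have [->|n3'] := eqVneq v2 (y + 1 + 1)]]);
rewrite ?(y1, y2, y3, y4, y5, y6, eqxx, andbF, orbF, andbT, addbF, addbb,
  addFb) //=;
clear y1 y2 y3 y4 y5 y6; lia.
Qed.

(** The corrections telescope along the chain, and they vanish at its two ends because neither end
    lies in row [c.2 + 1]. *)
Lemma parity_up (c u : int * int) p :
    path near_cell u p -> c \notin u :: p -> (c.1, c.2 + 1) \notin u :: p ->
    u.2 <= c.2 -> c.2 + 1 < (last u p).2 ->
  parity (c.1, c.2 + 1) u p = parity c u p.
Proof.
move=> up c1 c2 uc lc.
suff -> : parity (c.1, c.2 + 1) u p
    = parity c u p (+) (right_above c u (+) right_above c (last u p)).
  have -> : right_above c u = false by rewrite /right_above; lia.
  have -> : right_above c (last u p) = false by rewrite /right_above; lia.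
  by rewrite !addbF.
elim: p u up c1 c2 {uc lc} => [|v p IH] u; first by rewrite /= addbb.
move=> /= /andP[nuv vp]; rewrite inE negb_or => /andP[cu cp].
rewrite inE negb_or => /andP[cu' cp'].
rewrite IH //; move: cp cp'; rewrite !inE !negb_or => /andP[cv _] /andP[cv' _].
rewrite crosses_up //.
rewrite -!addbA; congr (_ (+) _); rewrite [RHS]addbCA; congr (_ (+) _).
by rewrite addbCA addKb.
Qed.

(** Here every step between the rows [c.2] and [c.2 + 1] counts, so the parity records whether the
    ends of the chain lie on different sides of the line between these rows. *)
Lemma parity_left_of (c u : int * int) p :
    (forall w, w \in u :: p -> w.2 = c.2 -> c.1 < w.1) ->
    path near_cell u p ->
  parity c u p = (u.2 <= c.2) (+) ((last u p).2 <= c.2).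
Proof.
elim: p u => /= [|v p IH] u far; first by rewrite addbb.
move=> /andP[uv vp]; rewrite IH // ?addbA; last first.
  by move=> w wp; apply: far; rewrite inE wp orbT.
congr (_ (+) _); have := far u (mem_head _ _); have := far v.
rewrite !inE eqxx orbT => /(_ isT); move: uv; rewrite /crosses /near_cell.
case: c u v {IH far vp} => [x y] [u1 u2] [v1 v2] /=.
have [->|n1] := eqVneq u2 y; have [->|n2] := eqVneq v2 y; lia.
Qed.

Lemma parity_right_of (c u : int * int) p :
    (forall w, w \in u :: p -> w.2 = c.2 -> w.1 <= c.1) ->
  parity c u p = false.
Proof.
elim: p u => //= v p IH u far; rewrite IH; last first.
  by move=> w wp; apply: far; rewrite inE wp orbT.
have := far u (mem_head _ _); have := far v.
rewrite !inE eqxx orbT => /(_ isT); rewrite /crosses.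
by case: c u v {IH far} => [x y] [u1 u2] [v1 v2] /=; lia.
Qed.

Lemma parity_side (c c' u : int * int) p :
    path near_cell u p -> c \notin u :: p -> c' \notin u :: p ->
    u.2 <= c.2 -> u.2 <= c'.2 -> c.2 < (last u p).2 -> c'.2 < (last u p).2 ->
    side_cell c c' ->
  parity c u p = parity c' u p.
Proof.
move=> up cp c'p u1 u2 l1 l2.
have [->|nc] := eqVneq c c'; first by [].
move: nc => /[swap] /andP[ncc sc] nc.
have [|[|[]]] : (c' = (c.1 + 1, c.2)) \/ (c = (c'.1 + 1, c'.2)) \/
  (c' = (c.1, c.2 + 1)) \/ (c = (c'.1, c'.2 + 1)).
- move: nc ncc sc; rewrite /near_cell -pair_eqE.
  case: c c' {cp c'p u1 u2 l1 l2} => [x y] [x' y'] /= nc ncc sc.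
  have : (x' == x + 1) && (y' == y) || (x == x' + 1) && (y == y') ||
    (x' == x) && (y' == y + 1) || (x == x') && (y == y' + 1) by lia.
  by case/orP => [/orP[/orP[]|]|] /andP[/eqP-> /eqP->]; tauto.
- by move=> e; rewrite e parity_right // -e.
- by move=> e; rewrite e parity_right // -e.
- by move=> e; rewrite e parity_up // -?e //; move: l2; rewrite e.
- by move=> e; rewrite e parity_up // -?e //; move: l1; rewrite e.
Qed.


(** * Chains of cells and periodic barriers *)

Definition reach (P : pred (int * int)) (u v : int * int) : Prop :=
  exists p, [/\ path near_cell u p, last u p = v & all P (u :: p)].

Lemma reach_trans (P : pred (int * int)) v u w :
  reach P u v -> reach P v w -> reach P u w.
Proof.
move=> [p [up <- /=/andP[Pu Pp]]] [q [vq <- /=/andP[_ Pq]]].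
by exists (p ++ q); rewrite cat_path up vq last_cat /= all_cat Pu Pp Pq.
Qed.

Lemma reach_near (P : pred (int * int)) u v :
  near_cell u v -> P u -> P v -> reach P u v.
Proof. by move=> uv Pu Pv; exists [:: v]; rewrite /= uv Pu Pv. Qed.

Lemma reach_map (P Q : pred (int * int)) (h : int * int -> int * int) u v :
    (forall w w', near_cell w w' -> near_cell (h w) (h w')) ->
    (forall w, P w -> Q (h w)) ->
  reach P u v -> reach Q (h u) (h v).
Proof.
move=> hh PQ [p [up <- Pp]]; exists (map h p); split.
- by rewrite path_map; apply: sub_path up => w w'; apply: hh.
- by rewrite last_map.
- by rewrite -map_cons all_map; apply: sub_all Pp => w; apply: PQ.
Qed.

Lemma reach_shift (P Q : pred (int * int)) (x y : int) u v :
    (forall w, P w -> Q (w.1 + x, w.2 + y)) ->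
  reach P u v -> reach Q (u.1 + x, u.2 + y) (v.1 + x, v.2 + y).
Proof.
move=> PQ.
apply: (@reach_map P Q (fun w => (w.1 + x, w.2 + y)) u v) => // w w'.
by rewrite /near_cell /=; lia.
Qed.

Lemma reach_iter (P : pred (int * int)) (x y : int) (b : int * int) (n : nat) :
    (forall w, P w -> P (w.1 + x, w.2 + y)) ->
    reach P b (b.1 + x, b.2 + y) ->
  reach P b (b.1 + x *+ n, b.2 + y *+ n).
Proof.
move=> Pxy bP; elim: n => [|n IH].
  case: bP => p [_ _ /= /andP[Pb _]]; exists [::].
  by rewrite /= Pb !mulr0n !addr0; case: (b).
have /= := reach_shift Pxy IH; rewrite -!addrA -!mulrSr.
exact: reach_trans.
Qed.

(* [f] is the parity of the number of crossings of a horizontal ray with a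
   piece of the barrier that covers all rows between [0] and [H]. *)
Lemma barrier_separates (P : pred (int * int)) (a m lo hi H : int)
    (b : int * int) :
    0 < m ->
    (forall (k : int) w, P w -> P (w.1 + k * (a * m), w.2 + k * m)) ->
    (forall w, P w -> lo <= w.1 - a * w.2 <= hi) ->
    reach P b (b.1 + a * m, b.2 + m) ->
  exists f : int * int -> bool,
    [/\ forall c : int * int, 0 <= c.2 < H -> c.1 - a * c.2 < lo -> f c,
        forall c : int * int, 0 <= c.2 < H -> hi < c.1 - a * c.2 -> ~~ f c
      & forall c c' : int * int, 0 <= c.2 < H -> 0 <= c'.2 < H -> ~~ P c -> ~~ P c' ->
          side_cell c c' -> f c = f c'].
Proof.
move=> m0 Pper Pbnd bP.
have [N [N1 N2]] : exists N : nat, b.2 < N%:Z /\ H < b.2 + N%:Z.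
  by exists (`|b.2| + `|H| + 1)%N; clear; lia.
(* Take [N + N] periods and move them back by [N] periods: as [m >= 1], the chain then starts below
   row 0 and ends above row [H]. *)
have bN : reach P b (b.1 + (a * m) *+ (N + N), b.2 + m *+ (N + N)).
  by apply: reach_iter => // w /(Pper 1); rewrite !mul1r.
have {bN} := reach_shift (Pper (- N%:Z)) bN.
set u : int * int := (_, _); set v : int * int := (_, _) => -[p [up pv Pp]].
have [u0 vH] : u.2 < 0 /\ H < v.2.
  have Nm : N%:Z <= N%:Z * m by rewrite ler_peMr.
  rewrite /u /v /= mulNr mulrnDr -mulr_natl natz.
  by move: Nm N1 N2; set z := _%:Z * m; clearbody z; clear; lia.
have {}Pp w : w \in u :: p -> P w by move/allP: Pp; apply.
exists (fun c => parity c u p); split.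
- move=> c cH clo; rewrite parity_left_of // ?pv; last first.
    move=> w /Pp /Pbnd /andP[wlo _] wc; move: wlo; rewrite wc.
    by move/(lt_le_trans clo); rewrite ltrD2r.
  have -> : u.2 <= c.2 by clear -cH u0; lia.
  by have -> : v.2 <= c.2 = false by clear -cH vH; lia.
- move=> c cH chi; rewrite parity_right_of //.
  move=> w /Pp /Pbnd /andP[_ whi] wc; move: whi; rewrite wc.
  by move/le_lt_trans/(_ chi); rewrite ltrD2r => /ltW.
- move=> c c' cH cH' Pc Pc' cc'; apply: parity_side; rewrite ?pv //.
  + by apply: contra Pc; apply: Pp.
  + by apply: contra Pc'; apply: Pp.
  all: clear -cH cH' u0 vH. all: clearbody u v; lia.
Qed.

(** * Black cells of the periodic tiling *)

(** Residues make the pattern periodic; for [m > 0] they are nonnegative, so the absolute value only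
    changes their type. *)
Definition black (m : nat) (A : squares m) (c : int * int) : bool :=
  ~~ contains A `|(c.1 %% m)%Z|%N `|(c.2 %% m)%Z|%N.

Lemma blackD m (A : squares m) (k l : int) c :
  black A (c.1 + k * m, c.2 + l * m) = black A c.
Proof. by rewrite /black /= ![_ + _ * _]addrC !modzMDl. Qed.


Definition cell (m : nat) (p : 'I_m * 'I_m) : int * int :=
  (Posz p.1, Posz p.2).

Lemma itv_meet_near (R : realType) (m i j : nat) (x : R) :
    (0 < m)%N -> x \in `[i%:R / m%:R, i.+1%:R / m%:R] ->
    x \in `[j%:R / m%:R, j.+1%:R / m%:R] ->
  (i <= j.+1)%N.
Proof.
move=> m0; rewrite !in_itv /= => /andP[ix _] /andP[_ jx].
have := le_trans ix jx; rewrite ler_pM2r ?ler_nat //.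
by rewrite invr_gt0 ltr0n.
Qed.

Lemma square_adjacent_near (R : realType) m (W : squares m) p q :
  square_adjacent R W p q -> near_cell (cell p) (cell q).
Proof.
case/and4P=> _ _ _ /asboolP[[x y] [[/= px py] [/= qx qy]]].
have m0 : (0 < m)%N by case: p.1 => i /=; apply: leq_ltn_trans.
have [] := (itv_meet_near m0 px qx, itv_meet_near m0 qx px).
have [] := (itv_meet_near m0 py qy, itv_meet_near m0 qy py).
rewrite /near_cell /=; clear; lia.
Qed.

Lemma square_adjacent_sym (R : realType) m (W : squares m) :
  symmetric (square_adjacent R W).
Proof.
by move=> p q; rewrite /square_adjacent setIC [q == p]eq_sym andbCA.
Qed.

(** A path in the graph never leaves the complement of [A], and adjacent squares are near cells. The
    offset [(x, y)] allows the component to be used in any copy of the pattern. *)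
Lemma component_reach (R : realType) m (A K : squares m) (P : pred (int * int))
    (x y : int) (i j i' j' : nat) (u v : int * int) :
    (forall p, p \notin A -> P ((cell p).1 + x, (cell p).2 + y)) ->
    component R (~: A) K -> contains K i j -> contains K i' j' ->
    u = (i%:Z + x, j%:Z + y) -> v = (i'%:Z + x, j'%:Z + y) ->
  reach P u v.
Proof.
move=> PA [r rA ->] + + -> ->.
move=> /existsP[p /andP[rp /andP[/eqP<- /eqP<-]]].
move=> /existsP[q /andP[rq /andP[/eqP<- /eqP<-]]].
move: rp rq; rewrite !inE => rp rq.
have csym := sym_connect_sym (@square_adjacent_sym R m (~: A)).
have closed_A p1 p2 : connect (square_adjacent R (~: A)) p1 p2 ->
    p1 \notin A -> p2 \notin A.
  move=> /connectP[s + ->]; elim: s p1 => //= z s IH p1 /andP[xz zs] xA.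
  by apply: IH zs _; case/and4P: xz => _; rewrite inE.
have pA : p \notin A by apply: closed_A rp _; rewrite inE in rA.
have /connectP[s ps ->] : connect (square_adjacent R (~: A)) p q.
  by apply: connect_trans rq; rewrite csym.
apply: (@reach_shift (fun c => P (c.1 + x, c.2 + y)) P x y (cell p)
  (cell (last p s))) => //.
exists (map (@cell m) s); split.
- by rewrite path_map; apply: sub_path ps; exact: square_adjacent_near.
- by rewrite last_map.
- rewrite -[_ :: _]/(map (@cell m) (p :: s)) all_map.
  apply/allP => t; rewrite inE => /predU1P[->|ts]; first exact: PA.
  apply: PA.
  apply: (closed_A p) => //.
  case/path.splitP: ts ps => s1 s2; rewrite cat_path => /andP[ps1 _].
  by apply/connectP; exists (rcons s1 t); rewrite ?last_rcons.
Qed.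

Lemma black_cell m (A : squares m) (p : 'I_m * 'I_m) (k l : int) :
  p \notin A -> black A ((cell p).1 + k * m, (cell p).2 + l * m).
Proof.
move=> pA; rewrite blackD /black !modz_nat !modn_small //.
apply/negP => /existsP[q /andP[qA /andP[/eqP q1 /eqP q2]]].
by case/negP: pA; have -> : p = q by case: p q q1 q2 {qA} => [? ?] [? ?] /=
  /val_inj-> /val_inj->.
Qed.

(** * The barrier given by each type *)

(* Exchanging the coordinates turns type H into type V. *)
Definition chart (T : pattern_type) (c : int * int) : int * int :=
  if T is TypeH then (c.2, c.1) else c.

(** In the coordinates of [chart T] the barrier has direction [(slope T, 1)], so
    [c.1 - slope T * c.2] does not change from one period to the next. *)
Definition slope (T : pattern_type) : int :=
  match T with TypeV | TypeH => 0 | TypeD1 => 1 | TypeD2 => -1 end.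

Definition barrier_cell T m (A : squares m) (c : int * int) : bool :=
  black A (chart T c) && (- (2 * m%:Z) <= c.1 - slope T * c.2 <= 2 * m%:Z).

Lemma reach_step (P : pred (int * int)) u v v' w :
  reach P u v -> near_cell v v' -> reach P v' w -> reach P u w.
Proof.
move=> uv vv' v'w; apply: reach_trans (uv) _; apply: reach_trans (v'w).
apply: reach_near vv' _ _.
- by case: uv => p [_ <- /allP]; apply; exact: mem_last.
- by case: v'w => p [_ _ /= /andP[]].
Qed.

(** On the base copy of the pattern the form lies between [-m] and [2m]. The condition on [(k, l)]
    says that moving to another copy adds 0 or [-m] to it, which keeps it within the band of
    [barrier_cell]. *)
Lemma barrier_cell_shift T m (A : squares m) (k l : int)
    (p : 'I_m * 'I_m) :
    -1 <= (chart T (k, l)).1 - slope T * (chart T (k, l)).2 <= 0 ->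
    p \notin A ->
  barrier_cell T A (chart T ((cell p).1 + k * m, (cell p).2 + l * m)).
Proof.
move=> kl pA; apply/andP; split.
  by have := black_cell k l pA; case: (T).
have [] := (ltn_ord p.1, ltn_ord p.2); rewrite /cell /=.
move: (nat_of_ord p.1) (nat_of_ord p.2) => x y xm ym.
have -> : (chart T (x%:Z + k * m, y%:Z + l * m)).1
    - slope T * (chart T (x%:Z + k * m, y%:Z + l * m)).2
    = (chart T (x%:Z, y%:Z)).1 - slope T * (chart T (x%:Z, y%:Z)).2
      + ((chart T (k, l)).1 - slope T * (chart T (k, l)).2) * m.
  by case: (T) => /=; ring.
move: kl; set d := (_ - _) => kl.
have : d = 0 \/ d = -1 by clearbody d; clear -kl; lia.
by case=> ->; rewrite ?mul0r ?mulN1r; case: (T) => /=; clear -xm ym; lia.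
Qed.

Lemma component_barrier (R : realType) T m (A K : squares m) (k l : int)
    (i j i' j' : nat) (u v : int * int) :
    -1 <= (chart T (k, l)).1 - slope T * (chart T (k, l)).2 <= 0 ->
    component R (~: A) K -> contains K i j -> contains K i' j' ->
    u = chart T (i%:Z + k * m, j%:Z + l * m) ->
    v = chart T (i'%:Z + k * m, j'%:Z + l * m) ->
  reach (barrier_cell T A) u v.
Proof.
move=> kl compK ij ij' -> ->.
apply: (@reach_map (fun c => barrier_cell T A (chart T c))) => //.
  rewrite /near_cell; case: (T) => w w' //= /and4P[h1 h2 h3 h4].
  by rewrite h1 h2 h3 h4.
apply: (component_reach (x := k * m) (y := l * m) _ compK ij ij') => // p.
exact: barrier_cell_shift.
Qed.

(** Components in neighbouring copies of the pattern are glued: [within_one], or the pair of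
    opposite corners, makes the exit cell of one copy touch the entry cell of the next. *)
Lemma type_reach (R : realType) T m (A : squares m) :
    (0 < m)%N -> has_type R T A ->
  exists b : int * int,
    reach (barrier_cell T A) b (b.1 + slope T * m, b.2 + m).
Proof.
move=> m0; have m1 : m.-1%:Z + 1 = m by lia.
have near1 i i' : within_one i i' -> i%:Z <= i'%:Z + 1 /\ i'%:Z <= i%:Z + 1.
  by rewrite /within_one; lia.
case: T.
- move=> [K [compK _ [i1 [i2 [top bot /near1[i12 i21]]]]]].
  exists (i2%:Z, 0).
  apply: (@reach_step _ _ (i1%:Z, m.-1%:Z) (i2%:Z, m%:Z)).
  + by apply: (@component_barrier R TypeV _ _ _ 0 0 _ _ _ _ _ _ _ compK bot top)
      => //=; congr pair; clear; lia.
  + by rewrite /near_cell /=; clear -i12 i21 m1; lia.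
  + by apply: (@component_barrier R TypeV _ _ _ 0 1 _ _ _ _ _ _ _ compK bot bot)
      => //=; congr pair; clear; lia.
- move=> [K [compK _ [j1 [j2 [left right /near1[j12 j21]]]]]].
  exists (j1%:Z, 0).
  apply: (@reach_step _ _ (j2%:Z, m.-1%:Z) (j1%:Z, m%:Z)).
  + by apply: (@component_barrier R TypeH _ _ _ 0 0 _ _ _ _ _ _ _ compK left right)
      => //=; congr pair; clear; lia.
  + by rewrite /near_cell /=; clear -j12 j21 m1; lia.
  + by apply: (@component_barrier R TypeH _ _ _ 1 0 _ _ _ _ _ _ _ compK left left)
      => //=; congr pair; clear; lia.
- case=> [[K [compK c00 c11]]|[K1 [K2 [[compK1 _] [compK2 _]]]]].
    exists (0, 0).
    apply: (@reach_step _ _ (m.-1%:Z, m.-1%:Z) (m%:Z, m%:Z)).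
    + by apply: (@component_barrier R TypeD1 _ _ _ 0 0 _ _ _ _ _ _ _ compK c00 c11)
        => //=; congr pair; clear; lia.
    + by rewrite /near_cell /=; clear -m1; lia.
    + by apply: (@component_barrier R TypeD1 _ _ _ 1 1 _ _ _ _ _ _ _ compK c00 c00)
        => //=; congr pair; clear; lia.
  (* The chain follows [K1] from left to top in copy (0,0), [K2] from bottom to right in copy (0,1),
     and enters [K1] again in copy (1,1). *)
  move=> [j1 [j2 [left right /near1[j12 j21]]]].
  move=> [i1 [i2 [top bot /near1[i12 i21]]]].
  exists (0, j1%:Z).
  apply: (@reach_step _ _ (i1%:Z, m.-1%:Z) (i2%:Z, m%:Z)).
  + by apply: (@component_barrier R TypeD1 _ _ _ 0 0 _ _ _ _ _ _ _ compK1 left top)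
      => //=; congr pair; clear; lia.
  + by rewrite /near_cell /=; clear -i12 i21 m1; lia.
  apply: (@reach_step _ _ (m.-1%:Z, j2%:Z + m) (m%:Z, j1%:Z + m)).
  + by apply: (@component_barrier R TypeD1 _ _ _ 0 1 _ _ _ _ _ _ _ compK2 bot right)
      => //=; congr pair; clear; lia.
  + by rewrite /near_cell /=; clear -j12 j21 m1; lia.
  + by apply: (@component_barrier R TypeD1 _ _ _ 1 1 _ _ _ _ _ _ _ compK1 left left)
      => //=; congr pair; clear; lia.
- case=> [[K [compK c01 c10]]|[K1 [K2 [[compK1 _] [compK2 _]]]]].
    exists (m%:Z, -1).
    apply: (@reach_step _ _ (m%:Z, -1) (m.-1%:Z, 0)).
    + by apply: (@component_barrier R TypeD2 _ _ _ 1 (-1) _ _ _ _ _ _ _ compK c01 c01)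
        => //=; congr pair; clear -m1; lia.
    + by rewrite /near_cell /=; clear -m1; lia.
    + by apply: (@component_barrier R TypeD2 _ _ _ 0 0 _ _ _ _ _ _ _ compK c10 c01)
        => //=; congr pair; clear -m1; lia.
  (* The chain starts on the left of [K1] in copy (1,-1), follows [K2] from right to top in copy
     (0,-1), then [K1] from bottom to left in copy (0,0). *)
  move=> [j1 [j2 [left right /near1[j12 j21]]]].
  move=> [i1 [i2 [bot top /near1[i12 i21]]]].
  exists (m%:Z, j1%:Z - m%:Z).
  apply: (@reach_step _ _ (m%:Z, j1%:Z - m%:Z) (m.-1%:Z, j2%:Z - m%:Z)).
  + by apply: (@component_barrier R TypeD2 _ _ _ 1 (-1) _ _ _ _ _ _ _ compK1 left left)
      => //=; congr pair; clear -m1; lia.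
  + by rewrite /near_cell /=; clear -j12 j21 m1; lia.
  apply: (@reach_step _ _ (i2%:Z, -1) (i1%:Z, 0)).
  + by apply: (@component_barrier R TypeD2 _ _ _ 0 (-1) _ _ _ _ _ _ _ compK2 right top)
      => //=; congr pair; clear -m1; lia.
  + by rewrite /near_cell /=; clear -i12 i21 m1; lia.
  + by apply: (@component_barrier R TypeD2 _ _ _ 0 0 _ _ _ _ _ _ _ compK1 bot left)
      => //=; congr pair; clear; lia.
Qed.

Lemma barrier_cellD T m (A : squares m) (k : int) c :
  barrier_cell T A (c.1 + k * (slope T * m), c.2 + k * m) = barrier_cell T A c.
Proof.
rewrite /barrier_cell /=; congr (_ && _).
  have -> : chart T (c.1 + k * (slope T * m), c.2 + k * m)
      = ((chart T c).1 + (chart T (k * slope T, k)).1 * m,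
         (chart T c).2 + (chart T (k * slope T, k)).2 * m).
    by case: (T) => /=; congr pair; ring.
  exact: blackD.
have -> // : c.1 + k * (slope T * m) - slope T * (c.2 + k * m)
  = c.1 - slope T * c.2 by ring.
Qed.

(* The black cells of one period of the barrier form a chain within a box of
   width [O(m)]; translating it places it between [c] and [c']. *)
Lemma type_separates (R : realType) T m (A : squares m) (H : int)
    (c c' : int * int) :
    (0 < m)%N -> has_type R T A ->
    0 <= c.1 < H -> 0 <= c.2 < H -> 0 <= c'.1 < H -> 0 <= c'.2 < H ->
    (chart T c).1 - slope T * (chart T c).2 + 6 * m%:Z
      < (chart T c').1 - slope T * (chart T c').2 ->
  exists2 f : int * int -> bool, f c != f c' &
    forall u v, 0 <= u.1 < H -> 0 <= u.2 < H -> 0 <= v.1 < H -> 0 <= v.2 < H ->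
      ~~ black A u -> ~~ black A v -> side_cell u v -> f u = f v.
Proof.
move=> m0 /(type_reach m0)[b bA] c1 c2 c'1 c'2.
set s := _ - _; set s' := _ - _ => ss'.
(* The band of half-width [2m] is centred at [t * m]. It starts at [(s %/ m + 1) * m > s] and ends
   at most at [s + 5m], before [s']. *)
pose t := (s %/ m)%Z + 3.
have [st ts'] : s < - (2 * m%:Z) + t * m /\ 2 * m%:Z + t * m < s'.
  have mn0 : m%:Z != 0 by rewrite -lt0n in m0 *; clear -m0; lia.
  have := divz_eq s m; have := ltz_mod s mn0; have := modz_ge0 s mn0.
  rewrite /t mulrDl; move: ss'; clearbody s s'; clear.
  move: (s %% m)%Z ((s %/ m)%Z * m) => r q; lia.
pose P (w : int * int) := barrier_cell T A (w.1 - t * m, w.2).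
have Pper (k : int) w : P w -> P (w.1 + k * (slope T * m), w.2 + k * m).
  rewrite /P addrAC.
  by rewrite (barrier_cellD T A k (w.1 - t * m, w.2)).
have Pbnd w : P w ->
    - (2 * m%:Z) + t * m <= w.1 - slope T * w.2 <= 2 * m%:Z + t * m.
  by rewrite /P /barrier_cell /= => /andP[_]; rewrite addrAC lerBrDr lerBlDr.
have bP : reach P (b.1 + t * m, b.2) (b.1 + t * m + slope T * m, b.2 + m).
  have := @reach_shift (barrier_cell T A) P (t * m) 0 _ _ _ bA.
  rewrite !addr0 addrAC; apply=> w.
  by rewrite /P /= addrK addr0; case: w.
have m0Z : 0 < m%:Z by rewrite ltz_nat.
have [f [flo fhi fP]] := barrier_separates H m0Z Pper Pbnd bP.
have chartH u : 0 <= u.1 < H -> 0 <= u.2 < H -> 0 <= (chart T u).2 < H.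
  by case: (T).
exists (fun u => f (chart T u)).
  by rewrite flo ?chartH // (negbTE (fhi _ _ _)) ?chartH.
have nP u : ~~ black A u -> ~~ P (chart T u).
  apply: contra; rewrite /P /barrier_cell => /andP[bu _]; move: bu.
  rewrite -(blackD A (chart T (- t, 0)).1 (chart T (- t, 0)).2 u).
  by case: (T); rewrite /= mulNr mul0r addr0.
move=> u v u1 u2 v1 v2 bu bv uv; apply: fP; rewrite ?chartH ?nP //.
case: (T) uv => //=; rewrite /side_cell orbC => /andP[uv ->].
by case/and4P: uv => h1 h2 h3 h4; rewrite andbT /near_cell /= h1 h2 h3 h4.
Qed.


(** * White cells, their ancestors and contacts at corners *)

Definition zcell (c : nat * nat) : int * int := (Posz c.1, Posz c.2).

Definition parent (k : nat) (c : nat * nat) : nat * nat :=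
  (c.1 %/ k, c.2 %/ k)%N.

Section WhiteCells.
Variables (m : nat -> nat) (A : forall k, squares (m k)).

Fixpoint white_cell (n : nat) (c : nat * nat) : bool :=
  match n with
  | 0%N => contains (A 0%N) c.1 c.2
  | n'.+1 => white_cell n' (parent (m n) c)
             && contains (A n) (c.1 %% m n) (c.2 %% m n)
  end.

Fixpoint width (n : nat) : nat :=
  if n is n'.+1 then (width n' * m n)%N else m 0%N.

(* The cell of level [n] that contains the cell [c] of level [d + n]. *)
Fixpoint ancestor (n d : nat) (c : nat * nat) : nat * nat :=
  if d is d'.+1 then ancestor n d' (parent (m (d + n)) c) else c.

Lemma white_cell_ancestor n d c :
  white_cell (d + n) c -> white_cell n (ancestor n d c).
Proof. by elim: d c => //= d IH c /andP[/IH]. Qed.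

Lemma contains_lt k (K : squares k) i j :
  contains K i j -> (i < k)%N && (j < k)%N.
Proof. by move=> /existsP[p /and3P[_ /eqP<- /eqP<-]]; rewrite !ltn_ord. Qed.

Lemma white_cell_lt n c : white_cell n c -> (c.1 < width n)%N && (c.2 < width n)%N.
Proof.
elim: n c => [|n IH] c /=; first exact: contains_lt.
case/andP=> /IH/=/andP[c1 c2] /contains_lt/andP[m0 _].
have {}m0 : (0 < m n.+1)%N by apply: leq_ltn_trans m0.
by rewrite -!ltn_divLR // c1 c2.
Qed.

Lemma contains_setC k (K : squares k) i j :
  contains K i j -> contains (~: K) i j = false.
Proof.
move=> /existsP[p /and3P[pK /eqP<- /eqP<-]]; apply/negbTE/negP => /existsP[q].
case/and3P=> qK /eqP q1 /eqP q2; move: qK; rewrite inE => /negP[].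
suff -> : q = p by [].
by case: p q q1 q2 {pK} => [? ?] [? ?] /= /val_inj-> /val_inj->.
Qed.

End WhiteCells.

(** The quotient grows between neighbours only at a block boundary, so the residues are the first
    and the last of a block. *)
Lemma succ_divn k i j :
    (0 < k)%N -> (i <= j.+1)%N -> (i %/ k = (j %/ k).+1)%N ->
  [/\ i = j.+1, (i %% k = 0)%N & (j %% k = k.-1)%N].
Proof.
move=> k0 ij e.
have := divn_eq i k; have := divn_eq j k.
have := ltn_pmod j k0; rewrite e mulSn.
move: (j %/ k * k)%N (i %% k)%N (j %% k)%N => q r s; clear e; split; lia.
Qed.

Lemma leq_divS k i j :
  (0 < k)%N -> (i <= j.+1)%N -> (i %/ k <= (j %/ k).+1)%N.
Proof.
move=> k0 ij; have : (i <= j + k)%N by rewrite (leq_trans ij) // -addn1 leq_add2l.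
by move/(leq_div2r k); rewrite divnDr // divnn k0 addn1.
Qed.

Lemma near_parent k c c' :
    (0 < k)%N -> near_cell (zcell c) (zcell c') ->
  near_cell (zcell (parent k c)) (zcell (parent k c')).
Proof.
move=> k0; rewrite /near_cell /= -!PoszD !lez_nat !addn1.
by case/and4P=> *; rewrite !leq_divS.
Qed.

(* [c'] touches [c] at its upper right corner if [s] holds and at its lower
   right corner otherwise. *)
Definition corner_touch (s : bool) (c c' : nat * nat) : bool :=
  (c'.1 == c.1.+1) && (if s then c'.2 == c.2.+1 else c.2 == c'.2.+1).

Definition type_C (s : bool) m (A : squares m) : bool :=
  if s then type_C1 A else type_C2 A.

(** Cells whose parents touch only at a corner can meet only at that corner. They then occupy the
    two opposite corner positions inspected by [type_C s], and both positions are white. *)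
Lemma corner_touch_parent (s : bool) k (A : squares k) c c' :
    (0 < k)%N -> near_cell (zcell c) (zcell c') ->
    contains A (c.1 %% k) (c.2 %% k) -> contains A (c'.1 %% k) (c'.2 %% k) ->
    corner_touch s (parent k c) (parent k c') ->
  corner_touch s c c' && ~~ type_C s A.
Proof.
move=> k0; rewrite /near_cell /= -!PoszD !lez_nat !addn1.
case/and4P=> l1 l2 l3 l4 Ac Ac' /andP[/eqP/=e1 e2].
have [c1 r1 r1'] := succ_divn k0 l2 e1.
rewrite r1 in Ac'; rewrite r1' in Ac; rewrite /corner_touch c1 eqxx.
case: s e2 => /= /eqP e2.
  have [c2 r2 r2'] := succ_divn k0 l4 e2.
  rewrite r2 in Ac'; rewrite r2' in Ac; rewrite c2 eqxx /=.
  by rewrite /type_C1 !contains_setC.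
have [c2 r2 r2'] := succ_divn k0 l3 e2.
rewrite r2 in Ac; rewrite r2' in Ac'; rewrite c2 eqxx /=.
by rewrite /type_C2 !contains_setC.
Qed.

Lemma near_ancestor m n d c c' :
    (forall k, 0 < m k)%N -> near_cell (zcell c) (zcell c') ->
  near_cell (zcell (ancestor m n d c)) (zcell (ancestor m n d c')).
Proof. by move=> m0; elim: d c c' => //= d IH c c' cc'; apply/IH/near_parent. Qed.

(** A corner contact between ancestors passes down to the same corner at each level, and each level
    passed excludes type C for its pattern. *)
Lemma corner_touch_ancestor s m (A : forall k, squares (m k)) n d c c' :
    (forall k, 0 < m k)%N -> near_cell (zcell c) (zcell c') ->
    white_cell A (d + n) c -> white_cell A (d + n) c' ->
    corner_touch s (ancestor m n d c) (ancestor m n d c') ->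
  corner_touch s c c' /\
  forall k, (n < k <= d + n)%N -> ~~ type_C s (A k).
Proof.
move=> m0; elim: d c c' => [|d IH] c c' cc'.
  by move=> _ _ ?; split=> // k /andP[/leq_trans h /h]; rewrite ltnn.
move=> /= /andP[wc Ac] /andP[wc' Ac'] /IH[||//|touch nC].
- exact: near_parent.
- by [].
have /andP[touch' nCd] := corner_touch_parent (m0 _) cc' Ac Ac' touch.
split=> // k /andP[nk]; rewrite leq_eqVlt => /predU1P[->//|kd].
by apply: nC; rewrite nk.
Qed.

(** Near cells without a common side touch at a corner in one of four ways: two values of [s], two
    orders of the cells. A pattern of each C type between the levels excludes them all. *)
Lemma side_ancestor m (A : forall k, squares (m k)) n d c c' :
    (forall k, 0 < m k)%N ->
    (forall s, exists2 k, (n < k <= d + n)%N & type_C s (A k)) ->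
    near_cell (zcell c) (zcell c') ->
    white_cell A (d + n) c -> white_cell A (d + n) c' ->
  side_cell (zcell (ancestor m n d c)) (zcell (ancestor m n d c')).
Proof.
move=> m0 Cs cc' wc wc'.
have no_touch s c1 c2 : near_cell (zcell c1) (zcell c2) ->
    white_cell A (d + n) c1 -> white_cell A (d + n) c2 ->
    ~~ corner_touch s (ancestor m n d c1) (ancestor m n d c2).
  move=> n12 w1 w2; apply/negP => t12.
  have [_ nC] := corner_touch_ancestor m0 n12 w1 w2 t12.
  by have [k /nC/negP nCk] := Cs s.
have c'c : near_cell (zcell c') (zcell c).
  by move: cc'; rewrite /near_cell => /and4P[-> -> -> ->].
have := near_ancestor n d m0 cc'.
have := no_touch true _ _ cc' wc wc'; have := no_touch false _ _ cc' wc wc'.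
have := no_touch true _ _ c'c wc' wc; have := no_touch false _ _ c'c wc' wc.
rewrite /side_cell /near_cell /corner_touch.
case: (ancestor m n d c) (ancestor m n d c') => [x y] [x' y'] /=.
clear; lia.
Qed.


(** * White squares as grid squares in the plane *)

Definition grid (R : realType) (N : nat) (c : nat * nat) : set (R * R) :=
  box (c.1%:R / N%:R) (c.2%:R / N%:R) N%:R^-1.
Arguments grid R N c : clear implicits.

Lemma gridP (R : realType) N c (z : R * R) : (0 < N)%N ->
  grid R N c z <-> (c.1%:R <= z.1 * N%:R <= c.1%:R + 1) /\
                   (c.2%:R <= z.2 * N%:R <= c.2%:R + 1).
Proof.
move=> N0; have N0R : 0 < N%:R :> R by rewrite ltr0n.
have aux (i : nat) (t : R) :
    (i%:R / N%:R <= t <= i%:R / N%:R + N%:R^-1)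
    = (i%:R <= t * N%:R <= i%:R + 1).
  rewrite ler_pdivrMr // -[X in _ + X]mul1r -mulrDl.
  by rewrite -ler_pdivlMr.
by rewrite /grid /box /= !in_itv /= !aux.
Qed.

Lemma closed_grid (R : realType) N c : closed (grid R N c).
Proof.
have cl (a b : R) (f : R * R -> R) : continuous f ->
    closed (f @^-1` `[a, b]).
  move=> /continuous_closedP; apply; exact: itv_closed.
rewrite /grid /box; apply: closedI; apply: cl => z; [exact: cvg_fst|exact: cvg_snd].
Qed.

(** White squares are sets of points, so the corner and side of the parent in [white] must be
    recovered from the set. *)
Lemma box_inj (R : realType) (x y q x' y' q' : R) :
    0 < q -> 0 < q' -> box x y q = box x' y' q' -> [/\ x = x', y = y' & q = q'].
Proof.
move=> q0 q'0 e.
have sub (a b s a' b' s' : R) : 0 < s ->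
    box a b s `<=` box a' b' s' ->
    [/\ a' <= a, b' <= b & a + s <= a' + s'].
  move=> s0 h.
  have [] : box a' b' s' (a, b) by apply: h; split; rewrite /= in_itv /=; lra.
  have [] : box a' b' s' (a + s, b).
    by apply: h; split; rewrite /= in_itv /=; lra.
  by rewrite /= !in_itv /= => /andP[_ ->] _ /andP[-> _] /andP[-> _].
have [] := sub x y q x' y' q' q0; first by rewrite e.
have [] := sub x' y' q' x y q q'0; first by rewrite e.
by split; lra.
Qed.

Lemma square_grid (R : realType) m (p : 'I_m * 'I_m) :
  square R p = grid R m (p.1 : nat, p.2 : nat).
Proof.
by rewrite /square /grid /box /= -![in LHS]natr1 !mulrDl !mul1r.
Qed.

Lemma place_grid (R : realType) M N c c' : (0 < M)%N -> (0 < N)%N ->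
  place (c.1%:R / M%:R) (c.2%:R / M%:R) (M%:R^-1 : R) @` grid R N c'
    = grid R (M * N) (c.1 * N + c'.1, c.2 * N + c'.2)%N.
Proof.
move=> M0 N0; have MN0 : (0 < M * N)%N by rewrite muln_gt0 M0.
have M0R : M%:R != 0 :> R by rewrite pnatr_eq0 -lt0n.
have N0R : N%:R != 0 :> R by rewrite pnatr_eq0 -lt0n.
have e1 (s i : R) : (M%:R^-1 * s + i / M%:R) * (M%:R * N%:R)
    = i * N%:R + s * N%:R by field.
apply/seteqP; split => [z [w /gridP-/(_ N0) [w1 w2] <-]|z].
  apply/gridP => //; rewrite /place /= !natrM !e1 !natrD !natrM.
  by rewrite -!addrA !lerD2l.
move/gridP => /(_ MN0); rewrite !natrM !natrD !natrM /= => -[z1 z2].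
exists (M%:R * z.1 - c.1%:R, M%:R * z.2 - c.2%:R).
  apply/gridP => //=; rewrite !mulrBl; split.
    by rewrite lerBrDl lerBlDl addrA -mulrA (mulrCA M%:R).
  by rewrite lerBrDl lerBlDl addrA -mulrA (mulrCA M%:R).
by case: z {z1 z2} => a b; rewrite /place /=; congr pair; field.
Qed.

Section WhiteGrid.
Variables (R : realType) (m : nat -> nat) (A : forall k, squares (m k)).
Hypothesis m_gt0 : forall k, (0 < m k)%N.

Lemma width_gt0 n : (0 < width m n)%N.
Proof. by elim: n => //= n IH; rewrite muln_gt0 IH m_gt0. Qed.

Lemma contains_ord k (K : squares k) (p : 'I_k * 'I_k) :
  p \in K -> contains K p.1 p.2.
Proof. by move=> pK; apply/existsP; exists p; rewrite pK !eqxx. Qed.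

Lemma white_grid n Y : white R A n Y ->
  exists2 c, white_cell A n c & Y = grid R (width m n) c.
Proof.
elim: n Y => [|n IH] Y /=.
  by move=> [p pA ->]; exists (p.1 : nat, p.2 : nat);
    [exact: contains_ord|exact: square_grid].
move=> [x [y [q [p [q0 /IH[c wc ec] pA ->]]]]].
have w0 : 0 < (width m n)%:R^-1 :> R by rewrite invr_gt0 ltr0n width_gt0.
have [-> -> ->] := box_inj q0 w0 ec.
exists (c.1 * m n.+1 + p.1, c.2 * m n.+1 + p.2)%N.
  rewrite /parent /= !divnMDl // !divn_small // !addn0 !modnMDl !modn_small //.
  by rewrite contains_ord // andbT; case: c wc {ec}.
by rewrite square_grid place_grid ?width_gt0.
Qed.

Lemma grid_parent n c :
  grid R (width m n.+1) c `<=` grid R (width m n) (parent (m n.+1) c).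
Proof.
move=> z /gridP-/(_ (width_gt0 _)) [z1 z2]; apply/gridP; first exact: width_gt0.
have aux (i M N : nat) (t : R) : (0 < N)%N ->
    i%:R <= t * (M * N)%:R <= i%:R + 1 ->
    (i %/ N)%:R <= t * M%:R <= (i %/ N)%:R + 1.
  move=> N0 /andP[h1 h2]; have N0R : 0 < N%:R :> R by rewrite ltr0n.
  rewrite -(ler_pM2r N0R) -mulrA -natrM -[in X in _ && X](ler_pM2r N0R).
  rewrite -mulrA -!natrM natr1 -natrM; apply/andP; split.
    by apply: le_trans h1; rewrite ler_nat leq_trunc_div.
  by apply: le_trans h2 _; rewrite natr1 ler_nat ltn_ceil.
by split; apply: aux.
Qed.

Lemma grid_ancestor n d c :
  grid R (width m (d + n)) c `<=` grid R (width m n) (ancestor m n d c).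
Proof.
by elim: d c => [|d IH] c z gz //; exact/IH/grid_parent.
Qed.

Lemma grid_near N c c' (z : R * R) : (0 < N)%N ->
  grid R N c z -> grid R N c' z -> near_cell (zcell c) (zcell c').
Proof.
move=> N0 /gridP-/(_ N0) [c1 c2] /gridP-/(_ N0) [c'1 c'2].
have aux (i j : nat) (t : R) :
    i%:R <= t <= i%:R + 1 -> j%:R <= t <= j%:R + 1 -> (i <= j.+1)%N.
  move=> /andP[h1 _] /andP[_ h2].
  by have := le_trans h1 h2; rewrite natr1 ler_nat.
have := aux _ _ _ c1 c'1; have := aux _ _ _ c'1 c1.
have := aux _ _ _ c2 c'2; have := aux _ _ _ c'2 c2.
by rewrite /near_cell /zcell /= -!PoszD !lez_nat !addn1 => -> -> -> ->.
Qed.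

End WhiteGrid.

(** * Colourings of connected sets, and linear forms *)

(** Each colour class is a finite union of closed sets, and the two classes are disjoint and cover
    [C]; hence each is relatively clopen in [C]. *)
Lemma connected_colour (T : topologicalType) (C : set T) (I : finType)
    (F : I -> set T) (g : I -> bool) :
    connected C -> (forall i, closed (F i)) -> C `<=` \bigcup_i F i ->
    (forall i j x, F i x -> F j x -> g i = g j) ->
  forall i j x y, C x -> F i x -> C y -> F j y -> g i = g j.
Proof.
move=> Cc Fcl Ccov gF i j x y Cx Fx Cy Fy.
have cl (b : bool) : closed (\bigcup_(k in [set k | g k == b]) F k).
  by apply: closed_bigcup => //; exact: finite_finset.
pose B := C `&` \bigcup_(k in [set k | g k == g i]) F k.
have BC : B = C.
  apply: Cc.
  - by exists x; split=> //; exists i => /=.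
  - exists (~` \bigcup_(k in [set k | g k == ~~ g i]) F k).
      exact/closed_openC/cl.
    apply/seteqP; split=> z [Cz].
      move=> [k /= /eqP gk Fk]; split=> // -[l /= /eqP gl Fl].
      by move: gl; rewrite (gF _ _ _ Fl Fk) gk; case: (g i).
    move=> nz; split=> //; have [k _ Fk] := Ccov z Cz.
    exists k => //=; apply/negPn/negP => gk; apply: nz; exists k => //=.
    by move: gk; case: (g k) (g i) => [] [].
  - by exists (\bigcup_(k in [set k | g k == g i]) F k).
have : B y by rewrite BC.
by case=> _ [k /= /eqP <- Fk]; exact: gF Fk Fy.
Qed.

Lemma infinite_set_unbounded (S : set nat) (N : nat) :
  infinite_set S -> exists2 n, (N < n)%N & S n.
Proof.
move=> Sinf; apply: contrapT => nS; apply: Sinf.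
apply: sub_finite_set (finite_II N.+1) => k Sk /=.
by rewrite ltnS leqNgt; apply/negP => kN; apply: nS; exists k.
Qed.


(** The real counterpart of [c.1 - slope T * c.2] in the coordinates of [chart T]. *)
Definition normal (R : realType) (T : pattern_type) (z : R * R) : R :=
  match T with
  | TypeV => z.1
  | TypeH => z.2
  | TypeD1 => z.1 - z.2
  | TypeD2 => z.1 + z.2
  end.

(** A rescaled point differs from the lower left corner of its cell by at most 1 in each coordinate,
    and the form has at most two coefficients, each 1 or -1. *)
Lemma normal_grid (R : realType) T N c (z : R * R) :
    (0 < N)%N -> grid R N c z ->
  `|normal T z * N%:R
    - ((chart T (zcell c)).1 - slope T * (chart T (zcell c)).2)%:~R| <= 2.
Proof.
move=> N0 /gridP-/(_ N0); move: (N%:R : R) => k [].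
case: c z => [i j] [x y] /=.
case: T; rewrite /= ?mul0r ?mul1r ?mulN1r ?opprK ?subr0 ?intrB ?intrD -?pmulrn;
  rewrite ler_norml; move: (i%:R : R) (j%:R : R) => a b /andP[h1 h2] /andP[h3 h4];
  apply/andP; split; lra.
Qed.

(** * Variation of the linear forms on connected subsets of the carpet *)

Section Carpet.
Variables (R : realType) (m : nat -> nat) (A : forall k, squares (m k)).
Hypothesis m_ge2 : forall k, (2 <= m k)%N.
Hypothesis C_unbounded :
  forall s (n : nat), exists2 k, (n < k)%N & type_C s (A k).

Let m_gt0 k : (0 < m k)%N. Proof. exact: ltnW. Qed.

Lemma normal_variation T n (C : set (R * R)) x y :
    connected C -> C `<=` carpet R A -> has_type R T (A n.+1) -> C x -> C y ->
  normal T y <= normal T x + 10 / (width m n)%:R.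
Proof.
move=> Cc CA TA Cx Cy; rewrite leNgt; apply/negP => xy.
have [k1 k1n Ck1] := C_unbounded true n.+1.
have [k2 k2n Ck2] := C_unbounded false n.+1.
(* Level [d + n.+1] is late enough for both [k1] and [k2] to lie between it and [n.+1]. *)
pose d := (k1 + k2)%N; pose N := width m (d + n.+1).
have Cs s : exists2 k, (n.+1 < k <= d + n.+1)%N & type_C s (A k).
  by case: s; [exists k1|exists k2] => //; rewrite ?k1n ?k2n /d -!addnA ?leq_addr
    // addnCA leq_addr.
(* Cells that are not white receive the empty set, so that the index type is finite and [F] covers
   exactly by white squares. *)
pose F (i : 'I_N * 'I_N) : set (R * R) :=
  [set z | white_cell A (d + n.+1) (i.1 : nat, i.2 : nat)
           /\ grid R N (i.1 : nat, i.2 : nat) z].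
have CF : C `<=` \bigcup_i F i.
  move=> z /CA /(_ (d + n.+1)%N I) [Y /(white_grid m_gt0)[c wc ->] zc].
  have /andP[c1 c2] := white_cell_lt wc.
  by exists (Ordinal c1, Ordinal c2) => //; split=> //=; case: c wc zc {c1 c2}.
have Fcl i : closed (F i).
  have [w|w] := boolP (white_cell A (d + n.+1) (i.1 : nat, i.2 : nat)).
    rewrite (_ : F i = grid R N (i.1 : nat, i.2 : nat)); first exact: closed_grid.
    by apply/seteqP; split=> z; [case|].
  rewrite (_ : F i = set0); first exact: closed0.
  by apply/seteqP; split=> z // -[]; rewrite (negbTE w).
have [i _ [wi xi]] := CF x Cx; have [j _ [wj yj]] := CF y Cy.
pose anc (i : 'I_N * 'I_N) := ancestor m n.+1 d (i.1 : nat, i.2 : nat).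
have ancW (k : 'I_N * 'I_N) (w : white_cell A (d + n.+1) (k.1 : nat, k.2 : nat)) :
    [/\ 0 <= (zcell (anc k)).1 < (width m n.+1)%:Z,
        0 <= (zcell (anc k)).2 < (width m n.+1)%:Z
      & ~~ black (A n.+1) (zcell (anc k))].
  have wa := white_cell_ancestor w.
  have /andP[k1W k2W] := white_cell_lt wa.
  split; rewrite ?ltz_nat //.
  by move: wa => /= /andP[_ wa]; rewrite /black /= !modz_nat negbK.
have W0 := width_gt0 m_gt0 n.+1.
have W0' := width_gt0 m_gt0 n.
have xa := normal_grid T W0 (grid_ancestor m_gt0 xi).
have ya := normal_grid T W0 (grid_ancestor m_gt0 yj).
have [i1 i2 _] := ancW i wi; have [j1 j2 _] := ancW j wj.
have [|f fij fside] := type_separates (m_gt0 n.+1) TA i1 i2 j1 j2.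
  (* At the scale of level [n.+1] the gap exceeds [10 * m n.+1]. Passing to the two cells costs 2
     each, and [10 * m n.+1 - 4 >= 6 * m n.+1]. *)
  rewrite -(ltr_int R) intrD.
  have m1 : (1 : R) <= (m n.+1)%:R by rewrite ler1n.
  have w0 : (0 : R) < (width m n)%:R by rewrite ltr0n.
  move: xa ya; rewrite -/(anc i) -/(anc j) !ler_norml.
  set s : R := (_ - _)%:~R; set s' : R := (_ - _)%:~R => /andP[xa _] /andP[_ ya].
  have : (normal T x + 10 / (width m n)%:R) * (width m n.+1)%:R
      < normal T y * (width m n.+1)%:R by rewrite ltr_pM2r // ltr0n.
  have e10 : 10 / (width m n)%:R * (width m n.+1)%:R = 10 * (m n.+1)%:R :> R.
    by rewrite /= natrM mulrA divfK ?gt_eqF.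
  have e6 : (6 * (m n.+1)%:Z)%:~R = 6 * (m n.+1)%:R :> R.
    by rewrite rmorphM /= rmorph_nat.
  by rewrite mulrDl e10 e6; lra.
(* A fine cell is coloured by the side of the barrier on which its ancestor lies. *)
pose g k := f (zcell (anc k)).
have gF k l z : F k z -> F l z -> g k = g l.
  move=> [wk zk] [wl zl].
  have [k1W k2W bk] := ancW k wk; have [l1W l2W bl] := ancW l wl.
  apply: fside => //; apply: side_ancestor => //.
  exact: grid_near (width_gt0 m_gt0 _) zk zl.
move/negP: fij; apply; apply/eqP.
exact: (connected_colour Cc Fcl CF gF Cx (conj wi xi) Cy (conj wj yj)).
Qed.

Lemma ltn_width n : (n < width m n)%N.
Proof.
elim: n => [|n IH] /=; first exact: m_gt0.
by rewrite (leq_trans _ (leq_mul IH (m_ge2 n.+1))) // muln2 -addnn addSn ltnS leq_addl.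
Qed.

Lemma normal_constant T (C : set (R * R)) x y :
    connected C -> C `<=` carpet R A -> infinite_set [set k | has_type R T (A k)] ->
    C x -> C y ->
  normal T x = normal T y.
Proof.
move=> Cc CA Tinf.
suff le z w : C z -> C w -> normal T w <= normal T z.
  by move=> Cx Cy; apply/le_anti; rewrite !le.
move=> Cz Cw; apply/ler_addgt0Pr => e e0.
(* The pattern of index [k = n.+1] gives a bound in terms of [width m n]; the extra successor
   ensures [10 / e < n < width m n]. *)
have [k kN /= Tk] := infinite_set_unbounded (Num.truncn (10 / e)).+1 Tinf.
case: k kN Tk => // n kN Tn.
apply: le_trans (normal_variation Cc CA Tn Cz Cw) _.
rewrite lerD2l ler_pdivrMr ?ltr0n ?(width_gt0 m_gt0) //.
rewrite mulrC -ler_pdivrMr //.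
have /ltW/le_trans -> // := truncnS_gt (10 / e).
by rewrite ler_nat (leq_trans _ (ltnW (ltn_width n))) // -ltnS.
Qed.

End Carpet.

Lemma normal_inj (R : realType) T1 T2 (x y : R * R) :
    T1 <> T2 -> normal T1 x = normal T1 y -> normal T2 x = normal T2 y ->
  x = y.
Proof.
case: x y => [x1 x2] [y1 y2].
by case: T1; case: T2 => //= _ h1 h2; congr pair; lra.
Qed.

Theorem theorem1 (R : realType) (m : nat -> nat) (A : forall k, squares (m k))
    (m_ge2 : forall k, (2 <= m k)%N)
    (A_nonempty : forall k, A k != finset.set0)
    (two_types : exists T1 T2 : pattern_type,
       [/\ T1 <> T2,
           infinite_set [set k | has_type R T1 (A k)]
         & infinite_set [set k | has_type R T2 (A k)]])
    (inf_C1 : infinite_set [set k | type_C1 (A k)])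
    (inf_C2 : infinite_set [set k | type_C2 (A k)]) :
  totally_disconnected (carpet R A).
Proof.
have C_unbounded s n : exists2 k, (n < k)%N & type_C s (A k).
  by case: s; apply: infinite_set_unbounded.
move: two_types => [T1 [T2 [T12 inf1 inf2]]] x Ax.
apply/seteqP; split=> [y [C [Cx CA Cc] Cy]|_ ->]; last first.
  exact: connected_component_refl.
by apply: (normal_inj T12); apply: normal_constant Cc CA _ Cy Cx.
Qed.
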